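(* Let $A=\{1,2\}$, with $A^{-}=\{1^{\ast},2^{\ast}\}$, and let $3^{A}=\left\langle 2^{A},2^{A^{-}}\right\rangle$ be its integer space with the fusion operation $\oplus$. Then $(3^{A},\oplus)$ satisfies the following conditions: 1. for all $X,Y\in 3^{A}$, $X\oplus Y\in 3^{A}$; 2. there is a unique element of $3^{A}$, namely $\emptyset$, such that for all $X\in 3^{A}$, $X\oplus\emptyset=\emptyset\oplus X=X$; 3. for every $X\in 3^{A}$ there is a unique $X^{-}\in 3^{A}$ such that $X\oplus X^{-}=X^{-}\oplus X=\emptyset$; 4. for all $X,Y\in 3^{A}$, $X\oplus Y=Y\oplus X$.
   Context: Background on $\sigma$-sets: in $\sigma$-set theory (a theory of classes) two elements $x,y$ are called antielements of each other when $\{x\}\cup\{y\}=\emptyset$, where $\cup$ here is the primitive pair union of the theory. If $x$ has an antielement it is denoted $x^{\ast}$; the relation is symmetric, so $(x^{\ast})^{\ast}=x$. A basic known fact of the theory is that a $\sigma$-set never contains both an element $x$ and its antielement $x^{\ast}$. $\sigma$-sets are determined by their elements, and $\emptyset$ is the $\sigma$-set with no elements. The natural numbers $1,2,3,\ldots$ and the antinatural numbers $1^{\ast},2^{\ast},3^{\ast},\ldots$ are pairwise distinct objects of the theory, and for each $n$ the antielement of $n$ is $n^{\ast}$ (and the antielement of $n^{\ast}$ is $n$). Definitions, for $\sigma$-sets $A,B$: - $2^{A}$ is the collection of all subsets of $A$. - $\ast$-intersection: $A\widehat{\cap}B=\{x\in A : x^{\ast}\in B\}$. - Difference: $A-B=\{x\in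 A: x\notin B\}$. - $\ast$-difference: $A\divideontimes B=A-(A\widehat{\cap}B)$. - Fusion: $A\oplus B=\{x : x\in A\divideontimes B\ \vee\ x\in B\divideontimes A\}$. - The $\sigma$-antiset $A^{-}$ of $A$ is the $\sigma$-set with $A\oplus A^{-}=\emptyset$. - Generated space: $\left\langle 2^{A},2^{B}\right\rangle=\{x\oplus y : x\in 2^{A}\wedge y\in 2^{B}\}$. - Integer space: $3^{A}=\left\langle 2^{A},2^{A^{-}}\right\rangle$. *)

(* Defs.v *)
From mathcomp Require Import all_boot.
From mathcomp Require Import boolp classical_sets.
From mathcomp Require Import zify.

Set Implicit Arguments.
Unset Strict Implicit.
Unset Printing Implicit Defensive.

Local Open Scope classical_set_scope.

Declare Scope sigma_scope.
Delimit Scope sigma_scope with sigma.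
Local Open Scope sigma_scope.

(* Sigma-set theory is a pure theory: the elements of a sigma-set are again
   sigma-sets.  A collection of sigma-sets is a [set U], which need not be the
   extension of a sigma-set: no sigma-set contains both an element and its
   antielement. *)
Record sigmaSig := SigmaSig {
  sset :> Type;
  mem : sset -> sset -> Prop;
  emp : sset;
  pair_union : sset -> sset -> sset }.

Arguments emp {_}.

Notation "x '\ins' A" := (mem x A) (at level 70, no associativity) : sigma_scope.

Section Definitions.
Variable U : sigmaSig.
Implicit Types (A B X Y x y : U).

(* "The" sigma-set satisfying P; junk value [emp] if there is none. *)
Definition the (P : set U) : U :=
  if pselect (exists X, P X) is left h then sval (cid h) else emp.

(* The sigma-set {x : P x}. *)
Definition setof (P : set U) : U := the [set X | forall x, x \ins X <-> P x].

Definition sing x : U := setof [set z | z = x].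
Definition upair x y : U := setof [set z | z = x \/ z = y].

Definition antielement x y : Prop := pair_union (sing x) (sing y) = emp.

Definition subsets A : set U := [set X | forall x, x \ins X -> x \ins A].

(* "x^* \in B" holds when x has an antielement and that antielement is in B. *)
Definition star_cap_pred A B : set U :=
  [set x | x \ins A /\ exists y, antielement x y /\ y \ins B].
Definition star_cap A B : U := setof (star_cap_pred A B).

Definition diff_pred A B : set U := [set x | x \ins A /\ ~ x \ins B].
Definition diff A B : U := setof (diff_pred A B).

Definition star_diff A B : U := diff A (star_cap A B).

Definition fusion_pred A B : set U :=
  [set x | x \ins star_diff A B \/ x \ins star_diff B A].
Definition fusion A B : U := setof (fusion_pred A B).

Definition antiset A : U := the [set B | fusion A B = emp].

Definition generated (F G : set U) : set U :=
  [set fusion x y | x in F & y in G].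

Definition integer_space A : set U :=
  generated (subsets A) (subsets (antiset A)).

Definition is_sset (P : set U) : Prop := exists X, forall x, x \ins X <-> P x.

(* The last three fields say that the classes which the definitions above call
   sigma-sets are sigma-sets; no comprehension schema is assumed. *)
Record sigma_axioms : Prop := SigmaAxioms {
  sigma_ext : forall X Y, (forall x, x \ins X <-> x \ins Y) -> X = Y;
  sigma_emp : forall x, ~ x \ins emp;
  sigma_sing : forall x, is_sset [set z | z = x];
  antielement_sym : forall x y, antielement x y -> antielement y x;
  antielement_uniq : forall x y z,
    antielement x y -> antielement x z -> y = z;
  antielement_excl : forall A x y,
    antielement x y -> x \ins A -> ~ y \ins A;
  sigma_star_cap : forall A B, is_sset (star_cap_pred A B);
  sigma_diff : forall A B, is_sset (diff_pred A B);
  sigma_fusion : forall A B, is_sset (fusion_pred A B) }.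

(* Indices start at 1: [num 0] and [antinum 0] are irrelevant. *)
Record numbers_axioms (num antinum : nat -> U) : Prop := NumbersAxioms {
  num_inj : forall m n, 0 < m -> 0 < n -> num m = num n -> m = n;
  antinum_inj : forall m n, 0 < m -> 0 < n -> antinum m = antinum n -> m = n;
  num_antinum : forall m n, 0 < m -> 0 < n -> num m <> antinum n;
  antielement_num : forall n, 0 < n -> antielement (num n) (antinum n) }.

Lemma setofP (P : set U) : is_sset P -> forall x, x \ins setof P <-> P x.
Proof.
by rewrite /setof /the => h; case: pselect => // h'; case: (cid h').
Qed.

End Definitions.

Notation "A (+) B" := (fusion A B) (at level 50, left associativity)
  : sigma_scope.

(* Consistency of the axioms.  The carrier is nat; 2k and 2k+1 are antielements
   of each other, and the k-th ternary digit of m says which of the two, if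
   any, belongs to m. *)
Section Model.

Let tmem (x m : nat) : Prop := (m %/ 3 ^ x./2) %% 3 = (odd x).+1.
Let partner (x : nat) : nat := if odd x then x.-1 else x.+1.

Let partner_half x : (partner x)./2 = x./2.
Proof. by rewrite /partner; case: ifP => ?; lia. Qed.

Let partner_odd x : odd (partner x) = ~~ odd x.
Proof. rewrite /partner; case: ifP => ?; lia. Qed.

Let partnerK x : partner (partner x) = x.
Proof. by rewrite {1}/partner partner_odd /partner; case: (boolP (odd x)) => ? /=; lia. Qed.

Let tmem_excl x m : tmem x m -> ~ tmem (partner x) m.
Proof. rewrite /tmem partner_half partner_odd; case: odd => ->; lia. Qed.

Let lt3 m : m < 3 ^ m.
Proof. exact: ltn_expl. Qed.

Let tmem_lt x m : tmem x m -> x < m.*2.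
Proof.
rewrite /tmem => h.
have : 3 ^ x./2 <= m.
  by rewrite leqNgt; apply/negP => hlt; move: h; rewrite divn_small.
have := lt3 x./2; lia.
Qed.

Let tmem_ext m n : (forall x, tmem x m <-> tmem x n) -> m = n.
Proof.
move=> h.
have digit k : (m %/ 3 ^ k) %% 3 = (n %/ 3 ^ k) %% 3.
  have := h k.*2; have := h k.*2.+1.
  have e0 : (k.*2)./2 = k by lia.
  have e1 : (k.*2.+1)./2 = k by lia.
  rewrite /tmem e0 e1 /= odd_double /=.
  have := ltn_pmod (m %/ 3 ^ k) (isT : 0 < 3).
  have := ltn_pmod (n %/ 3 ^ k) (isT : 0 < 3).
  lia.
have step k : m %% 3 ^ k = n %% 3 ^ k.
  elim: k => [|k IH]; first by rewrite !modn1.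
  have dec p : p %% 3 ^ k.+1 = (p %/ 3 ^ k) %% 3 * 3 ^ k + p %% 3 ^ k.
    rewrite expnSr [in LHS](divn_eq p (3 ^ k)) [in LHS](divn_eq (p %/ 3 ^ k) 3).
    have kp : 0 < 3 ^ k by rewrite expn_gt0.
    rewrite mulnDl -addnA -mulnA (mulnC 3) modnMDl modn_small //.
    have := ltn_pmod (p %/ 3 ^ k) (isT : 0 < 3); have := ltn_pmod p kp; nia.
  by rewrite !dec digit IH.
have := step (m + n); have := lt3 (m + n) => lt.
by rewrite !modn_small //; lia.
Qed.

Let tset (P : nat -> Prop) K :
  (forall x, P x -> x < K.*2) -> (forall x, P x -> ~ P (partner x)) ->
  exists m, m < 3 ^ K /\ forall x, tmem x m <-> P x.
Proof.
elim: K P => [|K IH] P bd cs.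
  exists 0; split=> // x; rewrite /tmem div0n mod0n; split=> // /bd; lia.
have [] := IH (fun x => P x /\ x < K.*2).
- by move=> x [].
- by move=> x [/cs h _] [].
move=> m [ltm hm].
pose d := if `[< P K.*2 >] then 1 else if `[< P K.*2.+1 >] then 2 else 0.
have ltd : d < 3 by rewrite /d; do 2?case: ifP.
have kp : 0 < 3 ^ K by rewrite expn_gt0.
exists (d * 3 ^ K + m); split; first by rewrite expnSr; nia.
move=> x; rewrite /tmem.
have [xl|xg] := ltnP x K.*2.
  have hk : K = (K - x./2.+1).+1 + x./2 by lia.
  have -> : d * 3 ^ K = (d * 3 ^ (K - x./2.+1) * 3) * 3 ^ x./2.
    by rewrite {1}hk expnD expnSr !mulnA.
  rewrite divnMDl ?expn_gt0 // modnMDl; rewrite -/(tmem x m) hm; tauto.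
have [xh|xh] := eqVneq x./2 K; last first.
  rewrite divn_small ?mod0n.
    split=> // /bd; lia.
  have : 3 ^ K.+1 <= 3 ^ x./2 by rewrite leq_exp2l //; lia.
  rewrite expnSr; nia.
rewrite xh divnMDl // (divn_small ltm) addn0 modn_small // /d.
have cs' := cs K.*2.
rewrite /partner odd_double in cs'.
have [ex|ex] : x = K.*2 \/ x = K.*2.+1 by lia.
  rewrite ex odd_double; case: asboolP => //; case: asboolP => //.
rewrite ex /= odd_double /=; case: asboolP => [p|np].
  by split=> // /cs'; tauto.
by case: asboolP.
Qed.

Let tset' (P : nat -> Prop) K :
  (forall x, P x -> x < K.*2) -> (forall x, P x -> ~ P (partner x)) ->
  exists m, forall x, tmem x m <-> P x.
Proof. by move=> bd /(tset bd)[m [_ h]]; exists m. Qed.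

Let tfus (X Y x : nat) : Prop :=
  (tmem x X \/ tmem x Y) /\ ~ (tmem (partner x) X \/ tmem (partner x) Y).

Let tunion_ex X Y : exists m, forall x, tmem x m <-> tfus X Y x.
Proof.
apply: (@tset' _ (X + Y)) => x; rewrite /tfus.
  by case=> -[/tmem_lt|/tmem_lt] + _; lia.
tauto.
Qed.

Let model := @SigmaSig nat tmem 0 (fun X Y => sval (cid (tunion_ex X Y))).

Let memE (x m : model) : (x \ins m) = tmem x m. Proof. by []. Qed.

Let unionE (X Y : model) x : x \ins pair_union X Y <-> tfus X Y x.
Proof. by rewrite /pair_union /=; case: cid. Qed.

Let temp (x : model) : ~ x \ins emp.
Proof. by rewrite memE /tmem div0n mod0n. Qed.

Let tsing (x : model) : is_sset [set z : model | z = x].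
Proof.
apply: (@tset' _ x.+1) => y /= ->; first by lia.
by rewrite /partner; case: ifP => ?; lia.
Qed.

Let antiE (x y : model) : antielement x y <-> y = partner x.
Proof.
have sP z := setofP (tsing z).
have px z : partner z <> z by rewrite /partner; case: ifP => ?; lia.
split=> [h|->].
  apply: contrapT => ne.
  have := @temp x; rewrite -h; apply; apply/unionE; split.
    by left; apply/sP.
  by case=> /sP; [exact: px | move=> /= e; apply: ne].
apply: tmem_ext => z; split=> [|/temp//].
case/unionE => -[/sP|/sP] /= -> [].
  by right; apply/sP.
by left; apply/sP; rewrite /= partnerK.
Qed.

Let capE (A B : model) x :
  star_cap_pred A B x <-> tmem x A /\ tmem (partner x) B.
Proof.
split=> [[xA [y [/antiE -> yB]]]//|[xA xB]].
by split=> //; exists (partner x); split=> //; apply/antiE.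
Qed.

Let tcap (A B : model) : is_sset (star_cap_pred A B).
Proof.
apply: (@tset' _ A) => x /capE[xA _]; first exact: tmem_lt.
by move=> /capE[/(tmem_excl xA)].
Qed.

Let tdiff (A B : model) : is_sset (diff_pred A B).
Proof.
apply: (@tset' _ A) => x [xA _]; first exact: tmem_lt.
by move=> [/(tmem_excl xA)].
Qed.

Let sdiffE (A B : model) x :
  x \ins star_diff A B <-> tmem x A /\ ~ tmem (partner x) B.
Proof.
split=> [/(setofP (tdiff _ _))[xA h]|[xA h]].
  by split=> // xB; apply: h; apply/(setofP (tcap _ _))/capE.
apply/(setofP (tdiff _ _)); split=> //.
by move=> /(setofP (tcap _ _))/capE[].
Qed.

Let tfusion (A B : model) : is_sset (fusion_pred A B).
Proof.
have [m h] := tunion_ex A B; exists m => x; apply: (iff_trans (h x)).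
have := @tmem_excl x A; have := @tmem_excl x B.
have := sdiffE A B x; have := sdiffE B A x => e1 e2 e3 e4.
change (tfus A B x <-> x \ins star_diff A B \/ x \ins star_diff B A).
by rewrite /tfus; tauto.
Qed.

Lemma sigma_axioms_consistent :
  exists (U : sigmaSig) (num antinum : nat -> U),
    sigma_axioms U /\ numbers_axioms num antinum.
Proof.
exists model, (fun n => n.*2), (fun n => n.*2.+1); split; split.
- exact: tmem_ext.
- exact: temp.
- exact: tsing.
- by move=> x y /antiE ->; apply/antiE; rewrite partnerK.
- by move=> x y z /antiE -> /antiE ->.
- by move=> A x y /antiE ->; exact: tmem_excl.
- exact: tcap.
- exact: tdiff.
- exact: tfusion.
- by move=> m n _ _; lia.
- by move=> m n _ _; lia.
- by move=> m n _ _; lia.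
- by move=> n _; apply/antiE; rewrite /partner odd_double.
Qed.

End Model.

(* Main.v *)
(* A sigma-set [B] with [A (+) B = emp] consists exactly of the antielements of
   the elements of [A], so it is unique.  The integer space of such an [A]
   consists of all the sigma-sets [Z] whose elements lie in [A] or [B]: the
   parts of [Z] outside [B] and outside [A] have fusion [Z], because [Z] never
   contains an element together with its antielement.  This makes closure
   immediate, and the inverse of [Z] is the fusion of [star_cap A Z] and
   [star_cap B Z]. *)
Require Import Defs.
From mathcomp Require Import all_boot.
From mathcomp Require Import boolp classical_sets.

Local Open Scope classical_set_scope.
Local Open Scope sigma_scope.

Section Fusion.
Context {U : sigmaSig} (HU : sigma_axioms U).
Implicit Types A B C X Y Z x y : U.

Lemma mem_sing x y : y \ins sing x <-> y = x.
Proof. exact: (setofP (sigma_sing HU x)). Qed.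

Lemma mem_diff A B x : x \ins diff A B <-> x \ins A /\ ~ x \ins B.
Proof. exact: (setofP (sigma_diff HU A B)). Qed.

Lemma mem_star_cap A B x :
  x \ins star_cap A B <-> x \ins A /\ exists y, antielement x y /\ y \ins B.
Proof. exact: (setofP (sigma_star_cap HU A B)). Qed.

Lemma mem_star_diff A B x :
  x \ins star_diff A B <->
  x \ins A /\ ~ exists y, antielement x y /\ y \ins B.
Proof. by rewrite /star_diff mem_diff mem_star_cap; tauto. Qed.

Lemma mem_fusion A B x :
  x \ins A (+) B <->
  (x \ins A /\ ~ exists y, antielement x y /\ y \ins B) \/
  (x \ins B /\ ~ exists y, antielement x y /\ y \ins A).
Proof.
by rewrite (setofP (sigma_fusion HU A B)) /fusion_pred /= !mem_star_diff.
Qed.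

Lemma fusion_mem_or A B x : x \ins A (+) B -> x \ins A \/ x \ins B.
Proof. by rewrite mem_fusion; tauto. Qed.

Lemma fusionC A B : A (+) B = B (+) A.
Proof. by apply: (sigma_ext HU) => x; rewrite !mem_fusion; tauto. Qed.

Lemma fusion0r A : A (+) emp = A.
Proof.
have no_emp := sigma_emp HU.
apply: (sigma_ext HU) => x; rewrite mem_fusion; split.
  by case=> -[] // /no_emp.
by move=> xA; left; split=> // -[y [_ /no_emp]].
Qed.

(** An element survives in the fusion exactly when the other side holds no antielement of it. This
    turns [A (+) B = emp] into two matching conditions. *)
Lemma fusion_eq0 A B :
  A (+) B = emp <->
  (forall x, x \ins A -> exists y, antielement x y /\ y \ins B) /\
  (forall x, x \ins B -> exists y, antielement x y /\ y \ins A).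
Proof.
split=> [AB0|[AB BA]].
  have nAB x : ~ x \ins A (+) B by rewrite AB0; exact: (sigma_emp HU).
  split=> x xin; apply: contrapT => nex; apply: (nAB x); apply/mem_fusion.
    by left.
  by right.
apply: (sigma_ext HU) => x; split=> [|/(sigma_emp HU)//].
by rewrite mem_fusion => -[] [] => [/AB|/BA].
Qed.

(** An element of [B] is the antielement of some [y] in [A], and [y] has an antielement in [C];
    since antielements are unique, the two coincide. *)
Lemma fusion_eq0_sub {A B C} :
  A (+) B = emp -> A (+) C = emp -> forall x, x \ins B -> x \ins C.
Proof.
move=> /fusion_eq0[_ BA] /fusion_eq0[AC _] x /BA[y [xy /AC[z [yz zC]]]].
by rewrite (antielement_uniq HU (antielement_sym HU xy) yz).
Qed.

Lemma fusion_eq0_inj {A B C} : A (+) B = emp -> A (+) C = emp -> B = C.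
Proof.
move=> AB0 AC0; apply: (sigma_ext HU) => x.
by split; [exact: (fusion_eq0_sub AB0) | exact: (fusion_eq0_sub AC0)].
Qed.

Lemma antiset_eq {A B} : A (+) B = emp -> antiset A = B.
Proof.
move=> AB0; rewrite /antiset /the; case: pselect => [h|[]]; last by exists B.
by case: (cid h) => C /= AC0; exact: (fusion_eq0_inj AC0 AB0).
Qed.

(** The pair is a sigma-set because it is the fusion of the two singletons, in which nothing
    cancels. *)
Lemma mem_upair x y :
  ~ antielement x y -> forall z, z \ins upair x y <-> z = x \/ z = y.
Proof.
move=> nxy; apply: setofP; exists (sing x (+) sing y) => z.
split=> [/fusion_mem_or|]; first by rewrite !mem_sing.
rewrite mem_fusion !mem_sing /=.
case=> ->; [left|right]; split=> // -[w []] + /mem_sing wE; rewrite wE //.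
by move=> /(antielement_sym HU).
Qed.

Lemma upair_fusion_eq0 x y x' y' :
  antielement x x' -> antielement y y' ->
  ~ antielement x y -> ~ antielement x' y' ->
  upair x y (+) upair x' y' = emp.
Proof.
move=> xx' yy' nxy nxy'; have sym := antielement_sym HU.
apply/fusion_eq0; split=> z /mem_upair => /(_ ltac:(assumption)) [] ->.
- by exists x'; split=> //; apply/mem_upair => //; left.
- by exists y'; split=> //; apply/mem_upair => //; right.
- by exists x; split; [exact: sym|apply/mem_upair => //; left].
- by exists y; split; [exact: sym|apply/mem_upair => //; right].
Qed.

Section IntegerSpace.
Context {A B : U} (AB0 : A (+) B = emp).

Lemma mem_integer_space Z :
  integer_space A Z <-> forall z, z \ins Z -> z \ins A \/ z \ins B.
Proof.
rewrite /integer_space (antiset_eq AB0) /generated; split.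
  case=> X XA [Y YB <-] z /fusion_mem_or[/XA|/YB]; first by left.
  by right.
move=> ZAB.
(* The antielement of [z] lies in [B], so [B] cannot also contain [z]. *)
have disj z : z \ins A -> ~ z \ins B.
  move=> zA; have [/(_ z zA)[y [zy yB]] _] := (fusion_eq0 A B).1 AB0.
  exact: (antielement_excl HU (antielement_sym HU zy) yB).
exists (diff Z B).
  by move=> z /mem_diff[/ZAB[]].
exists (diff Z A).
  by move=> z /mem_diff[/ZAB[]].
apply: (sigma_ext HU) => z; split.
  by move=> /fusion_mem_or[] /mem_diff[].
move=> zZ.
have nopp C : ~ exists y, antielement z y /\ y \ins diff Z C.
  by case=> y [zy /mem_diff[yZ _]]; exact: (antielement_excl HU zy zZ yZ).
apply/mem_fusion; case: (ZAB z zZ) => [zA|zB].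
  by left; split=> //; apply/mem_diff; split=> //; exact: disj.
by right; split=> //; apply/mem_diff; split=> // /disj.
Qed.

Lemma integer_space_fusion X Y :
  integer_space A X -> integer_space A Y -> integer_space A (X (+) Y).
Proof.
rewrite !mem_integer_space => SX SY z.
by move=> /fusion_mem_or[/SX|/SY].
Qed.

Lemma integer_space_emp : integer_space A emp.
Proof. by apply/mem_integer_space => z /(sigma_emp HU). Qed.

Lemma integer_space_inv X :
  integer_space A X -> exists2 Y, integer_space A Y & X (+) Y = emp.
Proof.
move=> /mem_integer_space SX.
have [AB BA] := (fusion_eq0 A B).1 AB0.
have sym := antielement_sym HU.
(* Nothing cancels in the inverse built below: the antielement of [y] is [x], and [x] in
   [star_cap C X] would put an antielement of [x] into [X] beside [x]. *)
have nopp C x y : antielement x y -> x \ins X ->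
    ~ exists z, antielement y z /\ z \ins star_cap C X.
  move=> xy xX [z [yz /mem_star_cap[_ [w [zw wX]]]]].
  move: zw wX; rewrite -(antielement_uniq HU (sym _ _ xy) yz) => xw wX.
  exact: (antielement_excl HU xw xX wX).
(* The first part collects the antielements of the elements of [X] in [B], the second those of the
   elements of [X] in [A]. *)
exists (star_cap A X (+) star_cap B X).
  apply/mem_integer_space => z /fusion_mem_or[] /mem_star_cap[]; first by left.
  by right.
apply/fusion_eq0; split=> x; last first.
  by move=> /fusion_mem_or[] /mem_star_cap[].
move=> xX; case: (SX x xX) => [/AB|/BA] [y [xy yin]]; exists y; split=> //.
  apply/mem_fusion; right; split; last exact: nopp xy xX.
  by apply/mem_star_cap; split=> //; exists x; split=> //; exact: sym.
apply/mem_fusion; left; split; last exact: nopp xy xX.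
by apply/mem_star_cap; split=> //; exists x; split=> //; exact: sym.
Qed.

End IntegerSpace.
End Fusion.

Theorem theorem3p1 (U : sigmaSig) (HU : sigma_axioms U)
    (num antinum : nat -> U) (Hnum : numbers_axioms num antinum) :
  let A := upair (num 1) (num 2) in
  let S := integer_space A in
  antiset A = upair (antinum 1) (antinum 2) /\
  (forall X Y, S X -> S Y -> S (X (+) Y)) /\
  unique (fun E => S E /\ forall X, S X -> X (+) E = X /\ E (+) X = X) emp /\
  (forall X, S X -> exists! Y, S Y /\ X (+) Y = emp /\ Y (+) X = emp) /\
  (forall X Y, S X -> S Y -> X (+) Y = Y (+) X).
Proof.
move=> A S.
have anti n : 0 < n -> antielement (num n) (antinum n).
  exact: (antielement_num Hnum).
have AB0 : A (+) upair (antinum 1) (antinum 2) = emp.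
  (* Neither pair cancels internally: the antielement of [num 1] is [antinum 1], not [num 2], and
     that of [antinum 1] is [num 1], not [antinum 2]. *)
  apply: (upair_fusion_eq0 HU); [exact: anti|exact: anti| |].
    move=> /(antielement_uniq HU (anti 1 isT)) /esym.
    exact: (num_antinum Hnum).
  move=> /(antielement_uniq HU (antielement_sym HU (anti 1 isT))).
  exact: (num_antinum Hnum).
have emp_id (X : U) : X (+) emp = X /\ emp (+) X = X.
  by split; [|rewrite (fusionC HU)]; exact: (fusion0r HU).
split; first exact: (antiset_eq HU AB0).
split; first exact: (integer_space_fusion HU AB0).
split.
  split; first by split; [exact: (integer_space_emp HU AB0)|].
  (* A neutral [E] is tested on [emp]: [emp (+) E] is both [emp] and [E]. *)
  move=> E [_ /(_ emp (integer_space_emp HU AB0))[+ _]].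
  by rewrite (emp_id E).2.
split; last by move=> X Y _ _; exact: (fusionC HU).
move=> X /(integer_space_inv HU AB0)[Y SY XY0].
exists Y; split; first by rewrite (fusionC HU Y).
(* Fusion is not associative, so the group argument for uniqueness fails; instead any inverse
   consists exactly of the antielements of the elements of [X]. *)
by move=> Z [_ [XZ0 _]]; exact: (fusion_eq0_inj HU XY0 XZ0).
Qed.
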